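(* For every $\varepsilon>0$ there exists $k_0$ such that for all integers $k\ge k_0$, \[w(3,k)\ge (1-\varepsilon)k^2.\] That is, $w(3,k)\ge (1-o(1))k^2$ as $k\to\infty$.
   Context: For an integer $k\ge 3$, the van der Waerden number $w(3,k)$ is the smallest positive integer $N$ such that for every coloring of $[N]=\{1,\dots,N\}$ with the two colors blue and red, there is either a blue arithmetic progression of length $3$ or a red arithmetic progression of length $k$. Arithmetic progressions are non-trivial, i.e. $\{a,a+d,\dots,a+(\ell-1)d\}$ with $d\neq 0$. *)

(* Defs.v *)
From mathcomp Require Import all_boot all_order all_algebra.
From mathcomp Require Import zify boolp.

Set Implicit Arguments.
Unset Strict Implicit.
Unset Printing Implicit Defensive.

Definition blue : bool := true.
Definition red : bool := false.

(* A coloring of [N] = {1, ..., N} is given by any extension nat -> bool of it: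
   only the values c 1, ..., c N are inspected.  Since a progression
   {a, a + d, ..., a + (l - 1) d} is the same set when read backwards, d <> 0
   amounts to d > 0. *)
Definition has_mono_ap (N : nat) (c : nat -> bool) (col : bool) (l : nat) : Prop :=
  exists a d : nat, 0 < d /\
    forall i, i < l -> 0 < a + i * d <= N /\ c (a + i * d) = col.

Definition vdw_property (l k N : nat) : Prop :=
  forall c : nat -> bool, has_mono_ap N c blue l \/ has_mono_ap N c red k.

(* Van der Waerden's theorem, by color focusing; it is what makes the minimum
   defining w exist.  The bound a + l * d < N leaves room for one extra term. *)
Definition vdw_bound (l : nat) (T : finType) (N : nat) : Prop :=
  forall c : nat -> T, exists a d : nat,
    [/\ 0 < d, a + l * d < N & forall i, i < l -> c (a + i * d) = c a].

(* s lists the (start, difference) pairs of m monochromatic progressions of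
   length l, of pairwise distinct colors, whose next term is always f. *)
Definition color_focused (T : finType) (l m N : nat) (c : nat -> T) : Prop :=
  exists (f : nat) (s : seq (nat * nat)),
    [/\ f < N, size s = m, uniq [seq c p.1 | p <- s] &
      forall p, p \in s -> [/\ 0 < p.2, p.1 + l * p.2 = f &
        forall i, i < l -> c (p.1 + i * p.2) = c p.1]].

Lemma color_focusing (T : finType) (l m : nat) : 0 < l ->
  (forall T' : finType, exists N, vdw_bound l T' N) ->
  exists N, 0 < N /\ forall c : nat -> T,
    (exists a d, [/\ 0 < d, a + l * d < N &
       forall i, i < l.+1 -> c (a + i * d) = c a])
    \/ color_focused l m N c.
Proof.
move=> l0 IHl; elim: m => [|m [N [N0 IHm]]].
  by exists 1; split=> // c; right; exists 0, [::].
have [W HW] := IHl {ffun 'I_N -> T}.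
exists (N * W.+1); split=> [|c]; first by rewrite muln_gt0 N0.
have [a [D [D0 aD HD]]] := HW (fun b => [ffun i : 'I_N => c (b * N + i)]).
have blockE i j : i < l -> j < N -> c ((a + i * D) * N + j) = c (a * N + j).
  by move=> il jN; have /ffunP/(_ (Ordinal jN)) := HD i il; rewrite !ffunE.
have aW : (a + l * D).+1 * N <= N * W.+1 by rewrite mulnC leq_mul2l ltnS ltnW ?orbT.
case: (IHm (fun j => c (a * N + j))) => [[b [d [d0 bd Hd]]]|].
  left; exists (a * N + b), d; split=> // [|i /Hd]; last by rewrite addnA.
  by nia.
move=> [f [s [fN sm us Hs]]].
have termE p i : p \in s -> i < l ->
    c (a * N + p.1 + i * (p.2 + D * N)) = c (a * N + p.1).
  move=> ps il; have [p0 pf pc] := Hs p ps.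
  have -> : a * N + p.1 + i * (p.2 + D * N) = (a + i * D) * N + (p.1 + i * p.2).
    by nia.
  by rewrite blockE ?pc //; nia.
case: (boolP (c (a * N + f) \in [seq c (a * N + p.1) | p <- s])) => [/mapP[p ps pE]|nf].
  have [p0 pf pc] := Hs p ps.
  left; exists (a * N + p.1), p.2; split=> // [|i]; first by nia.
  rewrite ltnS leq_eqVlt => /orP[/eqP->|/pc]; last by rewrite addnA.
  by rewrite -addnA pf.
right; exists ((a + l * D) * N + f).
exists ((a * N + f, D * N) :: [seq (a * N + p.1, p.2 + D * N) | p <- s]); split.
- by nia.
- by rewrite /= size_map sm.
- by rewrite /= -map_comp nf.
move=> p; rewrite inE => /orP[/eqP->|/mapP[q qs ->]] /=.
  split=> [||i il]; rewrite ?muln_gt0 ?D0 //; first by nia.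
  by rewrite -(blockE i f il fN); congr c; nia.
have [q0 qf _] := Hs q qs.
split=> [||i il]; [by rewrite addn_gt0 q0| |exact: termE].
by rewrite -qf mulnDr mulnDl mulnA [l * q.2 + _]addnC addnACA.
Qed.

Lemma vdw_multicolor (l : nat) (T : finType) : exists N, vdw_bound l.+1 T N.
Proof.
elim: l T => [|l IHl] T.
  by exists 2 => c; exists 0, 1; split=> // -[].
have [N [N0 HN]] := @color_focusing T l.+1 #|T|.+1 isT IHl.
exists (2 * N) => c; case: (HN c) => [[a [d [d0 ad Hd]]]|].
  by exists a, d; split=> //; nia.
move=> [f [s [_ sm us _]]].
have := max_card (mem [seq c p.1 | p <- s]).
by rewrite (card_uniqP us) size_map sm ltnn.
Qed.

Lemma vdw_exists (l k : nat) : exists N, (0 < N) && `[< vdw_property l k N >].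
Proof.
have [N HN] := vdw_multicolor (l + k) bool.
exists N.+1; apply/asboolP => c.
have [a [d [d0 ad Hd]]] := HN (fun i => c i.+1).
have H m : m <= l + k -> has_mono_ap N.+1 c (c a.+1) m.
  move=> mlk; exists a.+1, d; split=> // i im.
  by split; [nia|rewrite addSn Hd //; lia].
case E : (c a.+1) H => H; [left|right]; apply: H; lia.
Qed.

Definition w (l k : nat) : nat := ex_minn (vdw_exists l k).

(* Main.v *)
Require Import Defs.
From mathcomp Require Import all_boot all_order all_algebra.
From mathcomp Require Import boolp reals.
From mathcomp Require Import zify ring.
Import Order.TTheory GRing.Theory Num.Theory.

Set Implicit Arguments.
Unset Strict Implicit.
Unset Printing Implicit Defensive.

(** The interval [1, k^2] has a blue set free of 3-term progressions (APs) that
   meets every k-AP, so that w(3, k) > k^2 for large k.  Let p be a prime in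
   (k + 1, O(k log k)].  A k-AP inside [1, k^2] has difference d <= k + 1 < p,
   hence its terms have distinct residues mod p.  Write x = r + p u.
   The blue set is a union of pieces { r + p u : tau - u in U }, one for each
   of a few pairs (r, tau), where U consists of the integers below 3^n ~ k with
   all ternary digits in {0, 1}.  If the residues r form a set without 3-APs mod
   p, a blue 3-AP lies in a single piece, and there is none because U is free of
   3-APs.  A given k-AP is met by a proportion >= c 2^n / p of all pairs
   (r, tau), so by averaging one can pick the pairs greedily, each one meeting
   that proportion of the k-APs not met so far.  O((p / 2^n) log k) pairs
   suffice; this is o(sqrt k) because 2^n is about k^0.63, so the O(h^2)
   residues that would create a 3-AP with h earlier ones are never more than
   half of the k residues of a k-AP. *)

(** * Integers with ternary digits 0 and 1 *)

Fixpoint ternary (n : nat) : seq nat :=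
  if n is n'.+1 then
    [seq 3 * x | x <- ternary n'] ++ [seq (3 * x).+1 | x <- ternary n']
  else [:: 0].

Lemma size_ternary n : size (ternary n) = 2 ^ n.
Proof.
by elim: n => //= n IHn; rewrite size_cat !size_map IHn expnS mul2n addnn.
Qed.

Lemma ternaryS n x :
  reflect (exists2 y, y \in ternary n & x = 3 * y \/ x = (3 * y).+1)
          (x \in ternary n.+1).
Proof.
rewrite /= mem_cat; apply: (iffP orP) => [[|] /mapP[y yn ->]|[y yn [->|->]]].
- by exists y; [|left].
- by exists y; [|right].
- by left; apply: map_f.
- by right; apply/mapP; exists y.
Qed.

Lemma ternary_uniq n : uniq (ternary n).
Proof.
elim: n => //= n IHn; rewrite cat_uniq !map_inj_uniq ?IHn /= ?andbT; try by move=> x y; lia.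
by apply/hasPn => _ /mapP[x _ ->]; apply/mapP => -[y _]; lia.
Qed.

Lemma ternary_lt n x : x \in ternary n -> x < 3 ^ n.
Proof.
elim: n x => [|n IHn] x; first by rewrite inE => /eqP->.
by move/ternaryS => [y /IHn yn xy]; rewrite expnS; lia.
Qed.

(** Compare last digits: [x + z] and [2 * y] have last digits in {0, 1, 2} without carry, so the two
    sums of digits agree and the three digits are equal. Induction handles the rest. *)
Lemma ternary_ap_free n x y z :
  x \in ternary n -> y \in ternary n -> z \in ternary n ->
  x + z = 2 * y -> x = y.
Proof.
elim: n x y z => [|n IHn] x y z; first by rewrite !inE => /eqP-> /eqP->.
move=> /ternaryS[x' xn xE] /ternaryS[y' yn yE] /ternaryS[z' zn zE] xyz.
have : x' = y' by apply: (IHn _ _ z') => //; lia.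
lia.
Qed.

(** * Primes from the central binomial coefficient *)

Lemma exp2_le_bin m : 2 ^ m <= 'C(2 * m, m).
Proof.
elim: m => // m IHm.
have -> : 2 * m.+1 = (2 * m).+2 by lia.
rewrite binS -(@bin_sub (2 * m).+1 m.+1); last by lia.
have -> : (2 * m).+1 - m.+1 = m by lia.
rewrite addnn -mul2n expnS leq_mul2l /=; apply: leq_trans IHm _.
by rewrite leq_bin2l.
Qed.

(** By Legendre's formula each power p^k contributes floor(2m/p^k) - 2 floor(m/p^k) to the exponent.
    This is 0 or 1, and it is 0 once p^k > 2m. *)
Lemma logn_bin_le p m : prime p -> 0 < m ->
  p ^ logn p 'C(2 * m, m) <= 2 * m.
Proof.
move=> p_pr m0; have p1 := prime_gt1 p_pr.
set v := trunc_log p (2 * m).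
have [vm mv] : p ^ v <= 2 * m /\ 2 * m < p ^ v.+1.
  by split; [apply: trunc_logP; lia | apply: trunc_log_ltn].
apply: leq_trans (vm); rewrite leq_exp2l //.
have mm : m <= 2 * m by lia.
have := congr1 (logn p) (bin_fact mm).
have -> : 2 * m - m = m by lia.
rewrite !lognM ?fact_gt0 ?muln_gt0 ?bin_gt0 ?fact_gt0 //.
rewrite !logn_fact // => E.
(* The sum for m! is extended to the range of the sum for (2m)!; the new terms vanish because m < k
   < p^k. *)
have F : \sum_(1 <= k < m.+1) m %/ p ^ k = \sum_(1 <= k < (2 * m).+1) m %/ p ^ k.
  rewrite [RHS](@big_cat_nat _ _ _ m.+1) //=.
  rewrite -[LHS]addn0; congr (_ + _).
  rewrite big_nat_cond big1 // => k /andP[/andP[mk _] _].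
  by rewrite divn_small // (ltn_trans _ (ltn_expl k p1)).
have G : \sum_(1 <= k < (2 * m).+1) (2 * m) %/ p ^ k <=
   \sum_(1 <= k < (2 * m).+1) (m %/ p ^ k + m %/ p ^ k + (k <= v)).
  apply: leq_sum => k _; have [kv|vk] := leqP k v.
    rewrite mul2n -addnn divnD ?expn_gt0 ?(ltnW p1) //=.
    by rewrite leq_add2l leq_b1.
  rewrite divn_small //; apply: leq_trans mv _; rewrite leq_exp2l //.
have H : \sum_(1 <= k < (2 * m).+1) (k <= v) <= v.
  apply: leq_trans (_ : \sum_(1 <= k < v.+1) 1 <= _); last first.
    by rewrite sum_nat_const_nat muln1 subn1.
  rewrite -big_mkcond /=.
  have v2m : v <= 2 * m by rewrite (leq_trans _ vm) // ltnW // ltn_expl.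
  by rewrite [leqRHS](big_nat_widen _ _ (2 * m).+1) ?ltnS //.
move: G; rewrite !big_split /= -F => G; lia.
Qed.

(** Otherwise the binomial coefficient has at most k prime divisors, each contributing a factor at
    most 2m, so it is at most (2m)^k, against [exp2_le_bin]. *)
Lemma prime_between k m : 0 < m -> (2 * m) ^ k < 2 ^ m ->
  exists p, [/\ prime p, k < p & p <= 2 * m].
Proof.
move=> m0 km.
case: (pselect (exists p, [/\ prime p, k < p & p <= 2 * m])) => // no_prime.
have : 'C(2 * m, m) <= (2 * m) ^ k; last first.
  by rewrite leqNgt (leq_trans km) // exp2_le_bin.
have C0 : 0 < 'C(2 * m, m) by rewrite bin_gt0; lia.
have pk p : p \in primes 'C(2 * m, m) -> p \in iota 1 k.
  rewrite mem_primes mem_iota => /and3P[p_pr _ pC].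
  rewrite prime_gt0 //= add1n ltnS leqNgt; apply/negP => kp.
  case: no_prime; exists p; split=> //.
  apply: leq_trans (logn_bin_le p_pr m0).
  by rewrite -{1}(expn1 p) leq_exp2l ?prime_gt1 // logn_gt0 mem_primes p_pr C0.
rewrite {1}(prod_prime_decomp C0) prime_decompE big_map /=.
apply: (@leq_trans (\prod_(p <- primes 'C(2 * m, m)) (2 * m))).
  rewrite big_seq [leqRHS]big_seq; apply: leq_prod => p.
  by rewrite mem_primes => /and3P[p_pr _ _]; apply: logn_bin_le.
rewrite big_const_seq count_predT iter_muln_1 leq_exp2l; last by lia.
by rewrite -(size_iota 1 k) uniq_leq_size ?primes_uniq.
Qed.

(** * Greedy covering under a constraint *)

(** By double counting, some admissible x covers at least a proportion 1/q of the uncovered points,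
    so each step multiplies their number by at most 1 - 1/q. The proportion in [dense] is relative
    to all of X, although x is drawn from [next s]. *)
Lemma greedy_cover (T X : finType) (cov : X -> {set T}) (ok : seq X -> Prop)
    (next : seq X -> {set X}) (q h : nat) :
  0 < #|X| -> ok [::] ->
  (forall s x, ok s -> x \in next s -> ok (x :: s)) ->
  (forall s t, ok s -> size s < h ->
    #|X| <= q * #|[set x in next s | t \in cov x]|) ->
  exists s, [/\ ok s, size s <= h &
    #|[set t | ~~ has (fun x => t \in cov x) s]| * q ^ h <= #|T| * q.-1 ^ h].
Proof.
move=> X0 ok0 okS dense.
elim: h dense => [|h IHh] dense.
  by exists [::]; rewrite !muln1; split=> //; exact: max_card.
have [s|s [oks sh]] := IHh; first by move=> t oks sh; apply: dense => //; lia.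
set U := [set t | _] => Us.
have [U0|U0] := posnP #|U|.
  by exists s; rewrite -/U U0; split=> //; lia.
suff [x xs xU] : exists2 x, x \in next s & #|U| <= q * #|U :&: cov x|.
  exists (x :: s); split; [exact: okS|by []|].
  rewrite (_ : [set t | _] = U :\: cov x); last first.
    by apply/setP => t; rewrite !inE /= negb_or.
  have := cardsID (cov x) U; rewrite !expnS => E.
  have : #|U :\: cov x| * q <= #|U| * q.-1 by case: (q) xU => *; nia.
  by move=> F; nia.
apply/exists2P/not_existsP => no_x.
have: #|U| * #|X| <= \sum_(t in U) q * #|[set x in next s | t \in cov x]|.
  by rewrite -sum_nat_const; apply: leq_sum => t _; apply: dense.
apply/negP; rewrite -ltnNge -big_distrr /=.
under eq_bigr do rewrite -sum1dep_card.
rewrite (exchange_big_dep (mem (next s))) /=; last by move=> t x _ /andP[].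
under eq_bigr => x xs.
  rewrite (eq_bigl (mem (U :&: cov x))); last first.
    by move=> t; rewrite !inE xs.
  rewrite sum1_card; over.
rewrite big_distrr /=.
(* If no x works, each one satisfies q |U ∩ cov x| <= |U| - 1, which makes the double sum smaller
   than |U| |X|. *)
apply: (@leq_ltn_trans (\sum_(x in next s) #|U|.-1)).
  apply: leq_sum => x xs; rewrite -ltnS prednK // ltnNge.
  by apply/negP => xU; apply: (no_x x).
rewrite sum_nat_const mulnC.
by apply: (@leq_ltn_trans (#|U|.-1 * #|X|)); rewrite ?leq_mul2l ?max_card ?orbT ?ltn_pmul2r ?prednK.
Qed.

(** This is (1 - 1/q)^q <= 1/2. After q is replaced by its successor, [B] is Bernoulli's inequality
    (1 + 1/q)^j >= 1 + j/q with denominators cleared. *)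
Lemma double_expn_pred q : 0 < q -> 2 * q.-1 ^ q <= q ^ q.
Proof.
case: q => // q _ /=.
have B j : q ^ j * (q + j) <= q.+1 ^ j * q.
  elim: j => [|j IHj]; first by rewrite !expn0; lia.
  rewrite !expnS; move: IHj; move: (q ^ j) (q.+1 ^ j) => A D IHj.
  nia.
have [->|q0] := posnP q; first by [].
have := B q.+1; rewrite -(leq_pmul2r q0); move: (q ^ _) (q.+1 ^ _) => A D; nia.
Qed.

(** Every q greedy steps at least halve the uncovered set, so after q L steps fewer than one point
    is left. *)
Lemma cover_all (T X : finType) (cov : X -> {set T}) (ok : seq X -> Prop)
    (next : seq X -> {set X}) (q L : nat) :
  0 < q -> 0 < #|X| -> #|T| < 2 ^ L -> ok [::] ->
  (forall s x, ok s -> x \in next s -> ok (x :: s)) ->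
  (forall s t, ok s -> size s < q * L ->
    #|X| <= q * #|[set x in next s | t \in cov x]|) ->
  exists2 s, ok s & forall t, has (fun x => t \in cov x) s.
Proof.
move=> q0 X0 TL ok0 okS dense.
have [s [oks _ sU]] := greedy_cover X0 ok0 okS dense.
exists s => // t; apply/negPn/negP => ts.
have U0 : 0 < #|[set t | ~~ has (fun x => t \in cov x) s]|.
  by apply/card_gt0P; exists t; rewrite inE.
have : 2 ^ L * q.-1 ^ (q * L) <= q ^ (q * L).
  rewrite !expnM -expnMn; case: L {TL dense sU} => // L.
  by rewrite leq_exp2r ?double_expn_pred.
have qL : 0 < q ^ (q * L) by rewrite expn_gt0 q0.
move: U0 sU qL; move: #|[set t | _]| (q ^ (q * L)) (q.-1 ^ (q * L)) => A B C A0 AB B0 CB.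
have : #|T|.+1 * C <= 2 ^ L * C by rewrite leq_mul2r TL orbT.
have : B <= A * B by rewrite leq_pmull.
by rewrite mulSn; case: C CB AB => [|C]; nia.
Qed.

(** * An exponential estimate *)

Lemma exp_dominates (C : nat) :
  exists n0, forall n, n0 <= n -> C * n.+1 ^ 4 * 3 ^ n <= 4 ^ n.
Proof.
(* Write n = 15 i + j. Since 2 * 3^3 <= 4^3, the ratio (4/3)^(15 i) is at least 2^(5 i) >= (i +
   1)^5; four factors i + 1 absorb the polynomial and the fifth the constant. *)
exists (15 * (C * 15 ^ 4)) => n n0.
have iC : C * 15 ^ 4 <= n %/ 15 by rewrite leq_divRL // mulnC.
have ni : n.+1 <= 15 * (n %/ 15).+1 by rewrite mulnC; apply: ltn_ceil.
have {2 3}-> : n = (n %/ 15) * 15 + n %% 15 by exact: divn_eq.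
move: (n %/ 15) (n %% 15) iC ni => i j iC ni.
rewrite !expnD [_ * (_ * _)]mulnA leq_mul //; last first.
  by case: j => // j; rewrite leq_exp2r.
apply: (@leq_trans (i.+1 ^ 5 * 3 ^ (i * 15))).
  rewrite leq_mul2r (expnS i.+1 4); apply/orP; right.
  apply: (@leq_trans (C * (15 * i.+1) ^ 4)); first by rewrite leq_mul2l leq_exp2r // ni orbT.
  by rewrite expnMn mulnA leq_mul2r (leqW iC) orbT.
apply: (@leq_trans ((2 ^ i) ^ 5 * 3 ^ (i * 15))).
  by rewrite leq_mul2r leq_exp2r // ltn_expl ?orbT.
have -> : i * 15 = 3 * (i * 5) by lia.
by rewrite -expnM !(expnM _ 3) -expnMn; case: (i * 5) => // j'; rewrite leq_exp2r.
Qed.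

(** * Pieces of the blue set *)

(** The pair c is (r, tau). With the reflection tau - u, the values of tau suited to a given u are u
    + y with y in [ternary n], all nonnegative. The middle conjunct guards the truncated
    subtraction. *)
Definition hits (p n W : nat) (c : 'F_p * 'I_W.+1) (x : nat) : bool :=
  [&& (x%:R == c.1)%R, x %/ p <= c.2 & c.2 - x %/ p \in ternary n].

(** The conclusion equates pairs, not residues; with c3 = c1 it forces distinct pairs to have
    distinct residues when p is an odd prime or not. *)
Definition residues_ap_free (p W : nat) (s : seq ('F_p * 'I_W.+1)) : Prop :=
  forall c1 c2 c3, c1 \in s -> c2 \in s -> c3 \in s ->
  (c1.1 + c3.1 = c2.1 *+ 2)%R -> c1 = c2.

(** The residues of the three terms form a progression, so all three terms lie in one piece. Then p
    divides d, and the quotients by p give a progression in [ternary n]. *)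
Lemma hits_ap_free (p n W : nat) (s : seq ('F_p * 'I_W.+1)) c1 c2 c3 x d :
  prime p -> residues_ap_free s -> c1 \in s -> c2 \in s -> c3 \in s ->
  hits n c1 x -> hits n c2 (x + d) -> hits n c3 (x + 2 * d) -> d = 0.
Proof.
move=> p_pr s_free s1 s2 s3 /and3P[/eqP r1 u1 t1] /and3P[/eqP r2 u2 t2].
move=> /and3P[/eqP r3 u3 t3].
have c12 : c1 = c2.
  by apply: (s_free c1 c2 c3) => //; rewrite -r1 -r2 -r3 !natrD; ring.
have c32 : c3 = c2.
  by apply: (s_free c3 c2 c1) => //; rewrite -r1 -r2 -r3 !natrD; ring.
subst c1 c3.
have : p %| d.
  by rewrite (dvdn_pcharf (pchar_Fp p_pr)); move: r2; rewrite natrD r1 -[RHS]addr0 => /addrI ->.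
case/dvdnP => e dE; move: u2 t2 u3 t3; rewrite dE mulnA !divnDMl ?prime_gt0 //.
move=> u2 t2 u3 t3.
have E := ternary_ap_free t1 t2 t3; suff -> : e = 0 by []; lia.
Qed.

(** A new residue could be an end (first list) or the middle (second list) of a progression with two
    old ones. Taking c = c' in the first list excludes the old residues themselves. *)
Definition forbidden (p W : nat) (s : seq ('F_p * 'I_W.+1)) : seq 'F_p :=
  [seq (c.1 *+ 2 - c'.1)%R | c <- s, c' <- s] ++
  [seq ((c.1 + c'.1) / 2%:R)%R | c <- s, c' <- s].

Lemma residues_ap_free_cons (p W : nat) (s : seq ('F_p * 'I_W.+1)) c :
  prime p -> 2 < p -> residues_ap_free s -> c.1 \notin forbidden s ->
  residues_ap_free (c :: s).
Proof.
move=> p_pr p2 s_free; rewrite mem_cat negb_or => /andP[f1 f2].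
have two0 : (2%:R != 0 :> 'F_p)%R.
  by rewrite -(dvdn_pcharf (pchar_Fp p_pr)) gtnNdvd.
have {}f1 c1 c2 : c1 \in s -> c2 \in s -> (c.1 = c1.1 *+ 2 - c2.1)%R -> False.
  by move=> s1 s2 E; move/negP: f1; apply; rewrite E; apply: allpairs_f.
have {}f2 c1 c2 : c1 \in s -> c2 \in s -> (c1.1 + c2.1 = c.1 *+ 2)%R -> False.
  move=> s1 s2 E; move/negP: f2; apply.
  have -> : c.1 = ((c1.1 + c2.1) / 2%:R)%R by rewrite E -(mulr_natr c.1) mulfK.
  exact: allpairs_f.
have new c1 : c1 \in s -> c.1 = c1.1 -> False.
  by move=> s1 E; apply: (f1 c1 c1) => //; rewrite E mulr2n addrK.
have same (x y : 'F_p) : (x + x = y *+ 2 -> x = y)%R.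
  by rewrite -mulr2n -(mulr_natr x) -(mulr_natr y) => /(mulIf two0).
move=> c1 c2 c3; rewrite !inE.
move=> /orP[/eqP->|s1] /orP[/eqP->|s2] /orP[/eqP->|s3] // E;
  try exact: (s_free c1 c2 c3); exfalso.
- by apply: (new c2) => //; apply: same.
- by apply: (f1 c2 c3) => //; rewrite -E addrK.
- by apply: (new c1) => //; move: E; rewrite mulr2n => /addIr.
- by apply: (f2 c1 c3).
- by apply: (f1 c2 c1) => //; rewrite -E addrC addKr.
Qed.

(** The k terms have distinct residues mod p, and at most 2 |s|^2 of these are forbidden. Each
    remaining term, with quotient u, is hit by the 2^n pairs with tau = u + y, y in [ternary n]. *)
Lemma card_hits (p n W k a d : nat) (s : seq ('F_p * 'I_W.+1)) :
  prime p -> 0 < d < p -> k <= p ->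
  (forall i, i < k -> (a + i * d) %/ p + 3 ^ n <= W) ->
  (k - 2 * size s ^ 2) * 2 ^ n <=
  #|[set c : 'F_p * 'I_W.+1 | (c.1 \notin forbidden s)
     && [exists i : 'I_k, hits n c (a + i * d)]]|.
Proof.
move=> p_pr /andP[d0 dp] kp HW.
pose r (i : 'I_k) : 'F_p := ((a + i * d)%:R)%R.
have r_inj : injective r.
  suff lt (i j : 'I_k) : i <= j -> r i = r j -> i = j.
    by move=> i j; case: (leqP i j) => [|/ltnW] ij rij; [|symmetry]; apply: lt.
  move=> ij rij; apply/val_inj/eqP => /=; rewrite eqn_leq ij /= leqNgt.
  apply/negP => lt_ij.
  have : p %| (j - i) * d.
    rewrite (dvdn_pcharf (pchar_Fp p_pr)).
    have -> : (j - i) * d = (a + j * d) - (a + i * d) by nia.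
    by rewrite natrB ?leq_add2l ?leq_mul2r ?ij ?orbT // -/(r i) -/(r j) rij subrr.
  rewrite Euclid_dvdM // !gtnNdvd ?subn_gt0 //.
  by rewrite (leq_trans _ kp) // (leq_ltn_trans (leq_subr _ _)).
pose f (ij : 'I_k * 'I_(2 ^ n)) : 'F_p * 'I_W.+1 :=
  (r ij.1, inord ((a + ij.1 * d) %/ p + nth 0 (ternary n) ij.2)).
(* [HW] keeps the argument of [inord] in range, so its default value never occurs. *)
have f2E i j : (f (i, j)).2 = (a + i * d) %/ p + nth 0 (ternary n) j :> nat.
  rewrite inordK // ltnS (leq_trans _ (HW i (ltn_ord i))) // leq_add2l ltnW //.
  by apply: ternary_lt; rewrite mem_nth // size_ternary.
have f_inj : injective f.
  move=> [i j] [i' j'] E.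
  have ii : i = i' by apply: r_inj; case: E.
  rewrite -ii in E *; congr (_, _); apply/val_inj/eqP => /=.
  have := congr1 (fun c : 'F_p * 'I_W.+1 => nat_of_ord c.2) E.
  rewrite !f2E => /addnI /eqP; rewrite nth_uniq ?size_ternary //.
  exact: ternary_uniq.
pose I := [set i | r i \notin forbidden s].
have cardI : k - 2 * size s ^ 2 <= #|I|.
  rewrite leq_subLR -{1}(card_ord k) -(cardsC I) addnC leq_add2r.
  rewrite -(card_imset _ r_inj).
  apply: (@leq_trans #|forbidden s|).
    apply/subset_leq_card/subsetP => x /imsetP[i]; rewrite !inE negbK => ? ->.
    by [].
  apply: leq_trans (card_size _) _.
  by rewrite size_cat !size_allpairs mulnn addnn mul2n.
apply: (@leq_trans #|f @: setX I setT|).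
  by rewrite card_imset // cardsX cardsT card_ord leq_mul2r cardI orbT.
apply/subset_leq_card/subsetP => x /imsetP[[i j]].
rewrite !inE andbT => ri ->; rewrite ri /=.
apply/existsP; exists i; rewrite /hits f2E eqxx leq_addr /= addnC addnK.
by rewrite mem_nth // size_ternary.
Qed.

Lemma ap_free_hitting_set (p n k q L : nat) :
  prime p -> k.+1 < p -> 2 < k -> 3 ^ n <= k -> 6 * p <= q * 2 ^ n ->
  4 * (q * L) ^ 2 <= k -> (k * k).+1 * k.+2 < 2 ^ L ->
  exists B : nat -> bool,
    (forall x d, B x -> B (x + d) -> B (x + 2 * d) -> d = 0) /\
    (forall a d, 0 < d -> a + k.-1 * d <= k * k -> exists2 i, i < k & B (a + i * d)).
Proof.
move=> p_pr kp k2 n3k qn qLk TL.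
pose T := {t : 'I_(k * k).+1 * 'I_k.+2 | (0 < t.2) && (t.1 + k.-1 * t.2 <= k * k)}.
pose X : finType := ('F_p * 'I_(2 * k).+1)%type.
pose cov (c : X) := [set t : T | [exists i : 'I_k, hits n c ((val t).1 + i * (val t).2)]].
pose next (s : seq X) := [set c : X | c.1 \notin forbidden s].
have cardX : #|X| = p * (2 * k).+1 by rewrite card_prod card_Fp // card_ord.
have p0 := prime_gt0 p_pr.
have [||||||s s_free s_cov] := @cover_all T X cov (@residues_ap_free p (2 * k)) next q L.
- by case: q qn {qLk} => //; rewrite mul0n; lia.
- by rewrite cardX muln_gt0 p0.
- apply: leq_ltn_trans TL; rewrite card_sig (leq_trans (max_card _)) //.
  by rewrite card_prod !card_ord.
- by move=> c1 c2 c3.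
- move=> s c s_free; rewrite inE => cs.
  by apply: residues_ap_free_cons => //; lia.
- move=> s t s_free sL; have /andP[d0 adk] := valP t.
  have dk : (val t).2 < k.+2 := ltn_ord _.
  have dp : 0 < (val t).2 < p by rewrite d0 (leq_trans dk).
  (* Terms are at most k^2 < (k + 1) p, so the quotient is at most k, and so is 3^n; hence the range
     2k for tau. *)
  have HW i : i < k -> ((val t).1 + i * (val t).2) %/ p + 3 ^ n <= 2 * k.
    move=> ik; rewrite mul2n -addnn leq_add // -ltnS ltn_divLR //.
    apply: (@leq_ltn_trans (k * k)); last by nia.
    apply: leq_trans adk; rewrite leq_add2l leq_mul2r; apply/orP; right; lia.
  have H := card_hits s p_pr dp (ltnW (ltnW kp)) HW.
  have -> : [set x in next s | t \in cov x] = [set c : X | (c.1 \notin forbidden s)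
      && [exists i : 'I_k, hits n c ((val t).1 + i * (val t).2)]].
    by apply/setP => c; rewrite !inE.
  rewrite cardX; apply: (@leq_trans (q * ((k - 2 * size s ^ 2) * 2 ^ n))); last first.
    by rewrite leq_mul2l H orbT.
  (* At least k/2 residues remain allowed; with 6p <= q 2^n this gives q (k/2) 2^n >= 3kp >= p (2k +
     1). *)
  have sqL : 4 * size s ^ 2 <= k.
    by apply: leq_trans qLk; rewrite leq_mul2l leq_exp2r // ltnW.
  move: sqL qn; rewrite mulnCA; move: (size s ^ 2) (q * 2 ^ n) => S Q; nia.
exists (fun x => has (fun c => hits n c x) s); split.
  move=> x d /hasP[c1 s1 h1] /hasP[c2 s2 h2] /hasP[c3 s3 h3].
  exact: (hits_ap_free p_pr s_free s1 s2 s3 h1 h2 h3).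
move=> a d d0 adk.
have ak : a < (k * k).+1 by lia.
(* For k > 2, (k - 1)(k + 2) = k^2 + k - 2 exceeds k^2. *)
have dk : d < k.+2 by nia.
have tP : (0 < Ordinal dk) && (Ordinal ak + k.-1 * Ordinal dk <= k * k).
  by rewrite /= d0.
have := s_cov (exist _ (Ordinal ak, Ordinal dk) tP) => /hasP[c cs].
rewrite inE => /existsP[i hi]; exists i => //.
by apply/hasP; exists c.
Qed.

(** * Choice of parameters and the lower bound *)

Lemma log_prime_above (k l : nat) : 2 < k -> 4 < l -> k < 2 ^ l ->
  exists p, [/\ prime p, k.+1 < p & p <= 6 * (k * l)].
Proof.
move=> k2 l4 kl.
(* With m = 3kl, 2m = k (6l) <= 2^(2l), and 2l (k + 1) < 3kl because k > 2. *)
have [||p [p_pr kp pm]] := @prime_between k.+1 (3 * (k * l)).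
- by rewrite !muln_gt0; lia.
- apply: (@leq_ltn_trans ((2 ^ (2 * l)) ^ k.+1)).
    rewrite leq_exp2r // (mul2n l) -addnn expnD.
    have : 6 * l <= 2 ^ l.
      move: l4; clear; elim: l => // l IHl; rewrite ltnS leq_eqVlt.
      by case/predU1P => [<- //|l4]; have := IHl l4; rewrite expnS; lia.
    by move=> l6; have -> : 2 * (3 * (k * l)) = k * (6 * l); [lia|rewrite leq_mul // ltnW].
  by rewrite -expnM ltn_exp2l //; nia.
by exists p; split=> //; lia.
Qed.

Lemma large_parameters : exists k0, forall k, k0 <= k -> exists p n q L,
  [/\ prime p /\ k.+1 < p, 3 ^ n <= k, 6 * p <= q * 2 ^ n,
  4 * (q * L) ^ 2 <= k & (k * k).+1 * k.+2 < 2 ^ L].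
Proof.
(* 4 (q L)^2 is of order n^4 k^2 / 4^n while k < 3^(n + 1); the constant collects
   q <= 7 p / 2^n, p <= 6 k l and l = 2 (n + 1). *)
have [n0 big] := exp_dominates (64 * 49 * (36 * 48)).
exists (3 ^ (n0 + 3)) => k k0.
have kpos : 0 < k by rewrite (leq_trans _ k0) // expn_gt0.
pose n := trunc_log 3 k.
have n3k : 3 ^ n <= k by apply: trunc_logP.
have kn3 : k < 3 ^ n.+1 by apply: trunc_log_ltn.
have nn0 : n0 + 3 <= n.
  by rewrite -ltnS -(@ltn_exp2l 3) // (leq_ltn_trans k0).
have {}big : 64 * 49 * (36 * 48) * n.+1 ^ 4 * 3 ^ n <= 4 ^ n by apply: big; lia.
pose l := 2 * n.+1.
have kl : k < 2 ^ l.
  by rewrite (leq_trans kn3) // expnM leq_exp2r.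
have k2 : 26 < k.
  by rewrite (leq_trans _ k0) // (@leq_exp2l 3 3) // leq_addl.
have [||p [p_pr kp pl]] := @log_prime_above k l _ _ kl; [lia|rewrite /l; lia|].
(* q is 6p / 2^n rounded up, and L = 4l suffices since (k^2 + 1)(k + 2) < (k + 1)^4 <= 2^(4l). *)
exists p, n, (6 * p %/ 2 ^ n).+1, (4 * l); split=> //.
- by rewrite ltnW // ltn_ceil // expn_gt0.
(* Rounding costs at most 2^n <= 3^n <= k < p. *)
- set q := (6 * p %/ 2 ^ n).+1; have qn : q * 2 ^ n <= 7 * p.
    rewrite mulSn; have := leq_trunc_div (6 * p) (2 ^ n).
    have : 2 ^ n <= 3 ^ n by case: (n) => // j; rewrite leq_exp2r.
    lia.
  have q2 : q ^ 2 * 4 ^ n <= 49 * (6 * (k * l)) ^ 2.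
    rewrite (expnAC 2 2 n) -expnMn; apply: leq_trans (_ : (7 * p) ^ 2 <= _).
      by rewrite leq_exp2r.
    by rewrite expnMn leq_mul2l leq_exp2r // pl orbT.
  have pos4 : 0 < 4 ^ n by rewrite expn_gt0.
  rewrite -(leq_pmul2r pos4).
  have -> : 4 * (q * (4 * l)) ^ 2 * 4 ^ n = 64 * l ^ 2 * (q ^ 2 * 4 ^ n) by ring.
  apply: (@leq_trans (64 * l ^ 2 * (49 * (6 * (k * l)) ^ 2))).
    by rewrite leq_mul2l q2 orbT.
  have -> : 64 * l ^ 2 * (49 * (6 * (k * l)) ^ 2) =
      k * (64 * 49 * (36 * 16) * n.+1 ^ 4 * k) by rewrite /l; ring.
  rewrite leq_mul2l; apply/orP; right; apply: leq_trans big.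
  apply: (@leq_trans (64 * 49 * (36 * 16) * n.+1 ^ 4 * (3 * 3 ^ n))).
    by rewrite leq_mul2l -expnS (ltnW kn3) orbT.
  apply: eq_leq; ring.
- apply: (@leq_trans (k.+1 ^ 4)); last by rewrite mulnC expnM leq_exp2r.
  rewrite !expnS expn0; nia.
Qed.

Lemma w3_gt_sqr : exists k0, forall k, k0 <= k -> k * k < w 3 k.
Proof.
have [k0 H] := large_parameters.
exists (maxn 3 k0) => k; rewrite geq_max => /andP[k3 kk0].
have [p [n [q [L [[p_pr kp] n3k qn qLk TL]]]]] := H k kk0.
have [B [B3 Bk]] := ap_free_hitting_set p_pr kp k3 n3k qn qLk TL.
rewrite /w; case: ex_minnP => N /andP[_ /asboolP wN] _.
rewrite ltnNge; apply/negP => Nk.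
(* Colour by [B]. A red k-term progression within [N] ends at most at N <= k^2, so [Bk] puts a blue
   term in it. *)
case: (wN B) => -[a [d [d0 ap]]].
  have hit i : i < 3 -> B (a + i * d) by move=> /ap[_ ->].
  have := hit 0 isT; have := hit 1 isT; have := hit 2 isT.
  by rewrite mul0n mul1n addn0 => h2 h1 h0; move: d0; rewrite (B3 a d).
have k1k : k.-1 < k by lia.
have [/andP[_ adN] _] := ap _ k1k.
have [i ik Bi] := Bk a d d0 (leq_trans adN Nk).
by have [_] := ap i ik; rewrite Bi.
Qed.

Local Open Scope ring_scope.

Theorem theorem2 (R : realType) (eps : R) (eps_gt0 : 0 < eps) :
  exists k0 : nat, forall k : nat, (k0 <= k)%N ->
    (1 - eps) * k%:R ^+ 2 <= (w 3 k)%:R.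
Proof.
have [k0 H] := w3_gt_sqr; exists k0 => k /H kw.
apply: (@le_trans _ _ (k%:R ^+ 2)).
  by rewrite ler_piMl ?sqr_ge0 // lerBlDr lerDl ltW.
by rewrite -natrX ler_nat -mulnn ltnW.
Qed.
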